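(* Let $\epsilon\in\{0,\frac12\}$ and $b\in\mathbb{C}$. There exists a functor $F_{\epsilon,b}:\mathrm{Mod}\,\mathcal{SD}\to\mathrm{Mod}\,\mathfrak{g}[\epsilon]$ with $V\mapsto F_{\epsilon,b}(V)$, where $F_{\epsilon,b}(V)$ is the vector space $V$ with $\mathfrak{g}[\epsilon]$-action $$L_m\cdot v=-t^{m}\left(D+(m-2\epsilon)b+\frac{m+2\epsilon}{2}\theta\partial_\theta\right)v,$$ $$G_p\cdot v=t^{p-\epsilon}\left(\theta D+2(p-\epsilon)b\,\theta-t^{2\epsilon}\partial_\theta\right)v,$$ for $m\in\mathbb{Z}$, $p\in\mathbb{Z}+\epsilon$ and $v\in V$.
   Context: Everything is over $\mathbb{C}$; modules over superalgebras are $\mathbb{Z}_2$-graded. $\mathrm{Mod}\,L$ denotes the category of $L$-modules. Super-Virasoro algebra (centerless): for $\epsilon\in\{0,\frac12\}$, $\mathfrak{g}[\epsilon]$ is the Lie superalgebra with even basis $\{L_n\mid n\in\mathbb{Z}\}$, odd basis $\{G_p\mid p\in\mathbb{Z}+\epsilon\}$, and brackets $[L_m,L_n]=(m-n)L_{m+n}$, $[G_p,G_q]=2L_{p+q}$, $[L_m,G_p]=(\frac m2-p)G_{m+p}$. The Weyl superalgebra $\mathcal{SD}$ is the associative superalgebra generated by the even elements $t^{\pm1},\partial_t$ and the odd elements $\theta,\partial_\theta$, with $\partial_t t-t\partial_t=1$, $\partial_\theta\theta+\theta\partial_\theta=1$, $\theta^2=\partial_\theta^2=0$, and with $\theta,\partial_\theta$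 commuting with $t^{\pm1},\partial_t$. Put $D=t\partial_t$. *)

(* Defs.v *)
From HB Require Import structures.
From mathcomp Require Import all_boot all_order all_algebra.
From mathcomp Require Import generic_quotient finmap.
From mathcomp Require Import boolp reals complex.
From mathcomp Require Import monalg.
From mathcomp Require Import ring zify.

Set Implicit Arguments.
Unset Strict Implicit.
Unset Printing Implicit Defensive.

Import Order.TTheory GRing.Theory Num.Theory.
Local Open Scope ring_scope.

Record category := Category {
  obj :> Type;
  mor : obj -> obj -> Type;
  idmor : forall X, mor X X;
  compmor : forall X Y Z, mor Y Z -> mor X Y -> mor X Z;
  comp1m : forall X Y (f : mor X Y), compmor (idmor Y) f = f;
  compm1 : forall X Y (f : mor X Y), compmor f (idmor X) = f;
  compmA : forall W X Y Z (h : mor Y Z) (g : mor X Y) (f : mor W X),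
    compmor h (compmor g f) = compmor (compmor h g) f
}.

(* [F] is the object map: a functor is an [F] with a [functorial F]. *)
Record functorial (C D : category) (F : C -> D) := Functorial {
  fmap : forall X Y, mor X Y -> mor (F X) (F Y);
  fmap_id : forall X, fmap (idmor X) = idmor (F X);
  fmap_comp : forall X Y Z (g : mor Y Z) (f : mor X Y),
    fmap (compmor g f) = compmor (fmap g) (fmap f)
}.

(* [homog i v]: v is homogeneous of parity i ([false] even, [true] odd); the
   zero vector is homogeneous of both parities. *)
HB.mixin Record isSuper (K : numFieldType) V of GRing.Lmodule K V := {
  homog : bool -> V -> Prop;
  homog0 : forall i, homog i 0;
  homogP : forall i (a : K) (u v : V),
    homog i u -> homog i v -> homog i (a *: u + v);
  homog_sum : forall v : V,
    exists v0 v1 : V, [/\ homog false v0, homog true v1 & v = v0 + v1];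
  homog_direct : forall v : V, homog false v -> homog true v -> v = 0
}.

#[short(type="superspaceType")]
HB.structure Definition Super (K : numFieldType) :=
  {V of GRing.Lmodule K V & isSuper K V}.

HB.mixin Record Super_isAlgebra (K : numFieldType) A
    of GRing.Algebra K A & isSuper K A := {
  homogM : forall i j (x y : A),
    homog i x -> homog j y -> homog (i (+) j) (x * y)
}.

#[short(type="superalgType")]
HB.structure Definition SuperAlgebra (K : numFieldType) :=
  {A of GRing.Algebra K A & isSuper K A & Super_isAlgebra K A}.

HB.mixin Record Super_isLie (K : numFieldType) L of Super K L := {
  lie : L -> L -> L;
  lie_linearl : forall z : L, linear (lie^~ z);
  lie_linearr : forall z : L, linear (lie z);
  homog_lie : forall i j (x y : L),
    homog i x -> homog j y -> homog (i (+) j) (lie x y);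
  lie_skew : forall i j (x y : L), homog i x -> homog j y ->
    lie x y = - ((-1) ^+ (i && j) *: lie y x);
  lie_jacobi : forall i j k (x y z : L),
    homog i x -> homog j y -> homog k z ->
    lie x (lie y z) = lie (lie x y) z + (-1) ^+ (i && j) *: lie y (lie x z)
}.

#[short(type="lieSuperalgType")]
HB.structure Definition LieSuperalgebra (K : numFieldType) :=
  {L of Super K L & Super_isLie K L}.

Record alg_module (K : numFieldType) (A : superalgType K) := AlgModule {
  am_space :> superspaceType K;
  act : A -> am_space -> am_space;
  act_linearl : forall v, linear (act^~ v);
  act_linearr : forall x, linear (act x);
  act1 : forall v, act 1 v = v;
  actM : forall x y v, act (x * y) v = act x (act y v);
  homog_act : forall i j x v,
    homog i x -> homog j v -> homog (i (+) j) (act x v)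
}.

Record lie_action (K : numFieldType) (L : lieSuperalgType K)
    (V : superspaceType K) := LieAction {
  lact :> L -> V -> V;
  lact_linearl : forall v, linear (lact^~ v);
  lact_linearr : forall x, linear (lact x);
  lact_lie : forall i j x y v, homog i x -> homog j y ->
    lact (lie x y) v =
      lact x (lact y v) - (-1) ^+ (i && j) *: lact y (lact x v);
  homog_lact : forall i j x v,
    homog i x -> homog j v -> homog (i (+) j) (lact x v)
}.

Record lie_module (K : numFieldType) (L : lieSuperalgType K) := LieModule {
  lm_space :> superspaceType K;
  lm_action : lie_action L lm_space
}.

(* Morphisms of graded modules preserve the grading. *)
Record alg_hom (K : numFieldType) (A : superalgType K)
    (V W : alg_module A) := AlgHom {
  alg_hom_fun :> V -> W;
  alg_hom_linear : linear alg_hom_fun;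
  alg_hom_homog : forall i v, homog i v -> homog i (alg_hom_fun v);
  alg_hom_act : forall x v, alg_hom_fun (act x v) = act x (alg_hom_fun v)
}.

Record lie_hom (K : numFieldType) (L : lieSuperalgType K)
    (V W : lie_module L) := LieHom {
  lie_hom_fun :> V -> W;
  lie_hom_linear : linear lie_hom_fun;
  lie_hom_homog : forall i v, homog i v -> homog i (lie_hom_fun v);
  lie_hom_act : forall x v,
    lie_hom_fun (lm_action V x v) = lm_action W x (lie_hom_fun v)
}.

Section AlgModuleCategory.
Variables (K : numFieldType) (A : superalgType K).

Lemma alg_hom_ext (V W : alg_module A) (f g : alg_hom V W) : f =1 g -> f = g.
Proof.
case: f g => [f lf hf af] [g lg hg ag] /= /funext efg; case: _ / efg lg hg ag.
by move=> lg hg ag; congr AlgHom; apply: Prop_irrelevance.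
Qed.

Definition alg_hom_id (V : alg_module A) : alg_hom V V.
Proof. by exists id. Defined.

Definition alg_hom_comp (U V W : alg_module A)
  (g : alg_hom V W) (f : alg_hom U V) : alg_hom U W.
Proof.
exists (g \o f) => [a u v|i v hv|x v] /=.
- by rewrite alg_hom_linear alg_hom_linear.
- by do 2! apply: alg_hom_homog.
- by rewrite !alg_hom_act.
Defined.

Definition ModAlg : category.
Proof.
by refine (@Category (alg_module A) (@alg_hom K A) alg_hom_id alg_hom_comp
  _ _ _) => *; apply: alg_hom_ext.
Defined.

End AlgModuleCategory.

Section LieModuleCategory.
Variables (K : numFieldType) (L : lieSuperalgType K).

Lemma lie_hom_ext (V W : lie_module L) (f g : lie_hom V W) : f =1 g -> f = g.
Proof.
case: f g => [f lf hf af] [g lg hg ag] /= /funext efg; case: _ / efg lg hg ag.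
by move=> lg hg ag; congr LieHom; apply: Prop_irrelevance.
Qed.

Definition lie_hom_id (V : lie_module L) : lie_hom V V.
Proof. by exists id. Defined.

Definition lie_hom_comp (U V W : lie_module L)
  (g : lie_hom V W) (f : lie_hom U V) : lie_hom U W.
Proof.
exists (g \o f) => [a u v|i v hv|x v] /=.
- by rewrite lie_hom_linear lie_hom_linear.
- by do 2! apply: lie_hom_homog.
- by rewrite !lie_hom_act.
Defined.

Definition ModLie : category.
Proof.
by refine (@Category (lie_module L) (@lie_hom K L) lie_hom_id lie_hom_comp
  _ _ _) => *; apply: lie_hom_ext.
Defined.

End LieModuleCategory.

Variant sd_gen := gT | gTinv | gDt | gTh | gDth.

Definition gen_odd g := if g is (gTh | gDth) then true else false.

Section WeylSuperalgebra.
Variable K : numFieldType.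

(* SD is the quotient of the type of formal noncommutative expressions by the
   congruence generated by the axioms of unital associative K-algebras and
   the defining relations. *)
Inductive sd_term :=
  | Gen of sd_gen
  | Cst of K
  | Add of sd_term & sd_term
  | Mul of sd_term & sd_term.

Let T := Gen gT.
Let Tinv := Gen gTinv.
Let Dt := Gen gDt.
Let Th := Gen gTh.
Let Dth := Gen gDth.

Variant sd_rel : sd_term -> sd_term -> Prop :=
  | rel_ttinv : sd_rel (Mul T Tinv) (Cst 1)
  | rel_tinvt : sd_rel (Mul Tinv T) (Cst 1)
  | rel_dtt : sd_rel (Mul Dt T) (Add (Mul T Dt) (Cst 1))
  | rel_dthth : sd_rel (Add (Mul Dth Th) (Mul Th Dth)) (Cst 1)
  | rel_thth : sd_rel (Mul Th Th) (Cst 0)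
  | rel_dthdth : sd_rel (Mul Dth Dth) (Cst 0)
  | rel_comm g h : gen_odd g -> ~~ gen_odd h ->
      sd_rel (Mul (Gen g) (Gen h)) (Mul (Gen h) (Gen g)).

Inductive sd_eq : sd_term -> sd_term -> Prop :=
  | sd_eq_rel x y : sd_rel x y -> sd_eq x y
  | sd_eq_refl x : sd_eq x x
  | sd_eq_sym x y : sd_eq x y -> sd_eq y x
  | sd_eq_trans y x z : sd_eq x y -> sd_eq y z -> sd_eq x z
  | sd_eqD x x' y y' : sd_eq x x' -> sd_eq y y' -> sd_eq (Add x y) (Add x' y')
  | sd_eqM x x' y y' : sd_eq x x' -> sd_eq y y' -> sd_eq (Mul x y) (Mul x' y')
  | sd_addA x y z : sd_eq (Add x (Add y z)) (Add (Add x y) z)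
  | sd_addC x y : sd_eq (Add x y) (Add y x)
  | sd_add0 x : sd_eq (Add (Cst 0) x) x
  | sd_mulA x y z : sd_eq (Mul x (Mul y z)) (Mul (Mul x y) z)
  | sd_mul1 x : sd_eq (Mul (Cst 1) x) x
  | sd_mul0 x : sd_eq (Mul (Cst 0) x) (Cst 0)
  | sd_mulDl x y z : sd_eq (Mul (Add x y) z) (Add (Mul x z) (Mul y z))
  | sd_mulDr x y z : sd_eq (Mul x (Add y z)) (Add (Mul x y) (Mul x z))
  | sd_cstD a b : sd_eq (Cst (a + b)) (Add (Cst a) (Cst b))
  | sd_cstM a b : sd_eq (Cst (a * b)) (Mul (Cst a) (Cst b))
  | sd_cstC a x : sd_eq (Mul (Cst a) x) (Mul x (Cst a)).

HB.instance Definition _ := gen_eqMixin sd_term.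
HB.instance Definition _ := gen_choiceMixin sd_term.

Definition sd_equiv : rel sd_term := fun x y => `[< sd_eq x y >].

Lemma sd_equiv_class : equiv_class_of sd_equiv.
Proof.
split=> [x|x y|y x z]; first exact/asboolP/sd_eq_refl.
  by apply/asboolP/asboolP; apply: sd_eq_sym.
by move=> /asboolP xy /asboolP yz; apply/asboolP; apply: sd_eq_trans yz.
Qed.

Canonical sd_equiv_rel := EquivRelPack sd_equiv_class.

Definition SD : Type := {eq_quot sd_equiv}%qT.

HB.instance Definition _ := Choice.on SD.
HB.instance Definition _ := Quotient.on SD.

Definition sd_pi (x : sd_term) : SD := \pi_SD%qT x.

Lemma sd_piP x y : sd_pi x = sd_pi y <-> sd_eq x y.
Proof.
split; first by move/(@eqmodP _ sd_equiv_rel)/asboolP.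
by move=> h; apply/(@eqmodP _ sd_equiv_rel)/asboolP.
Qed.

Lemma sd_pi_ind (P : SD -> Prop) : (forall x, P (sd_pi x)) -> forall u, P u.
Proof. by move=> h u; rewrite -[u]reprK; apply: h. Qed.

Lemma sd_reprK x : sd_eq (repr (sd_pi x)) x.
Proof. by apply/sd_piP; rewrite /sd_pi reprK. Qed.

Definition sd_add (u v : SD) := sd_pi (Add (repr u) (repr v)).
Definition sd_mul (u v : SD) := sd_pi (Mul (repr u) (repr v)).
Definition sd_scale (a : K) (u : SD) := sd_pi (Mul (Cst a) (repr u)).

Lemma sd_addE x y : sd_add (sd_pi x) (sd_pi y) = sd_pi (Add x y).
Proof. by apply/sd_piP/sd_eqD; apply: sd_reprK. Qed.

Lemma sd_mulE x y : sd_mul (sd_pi x) (sd_pi y) = sd_pi (Mul x y).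
Proof. by apply/sd_piP/sd_eqM; apply: sd_reprK. Qed.

Lemma sd_scaleE a x : sd_scale a (sd_pi x) = sd_pi (Mul (Cst a) x).
Proof. by apply/sd_piP/sd_eqM; [apply: sd_eq_refl|apply: sd_reprK]. Qed.

Let sdE := (sd_addE, sd_mulE, sd_scaleE).

Fact sd_addrA : associative sd_add.
Proof.
elim/sd_pi_ind=> x; elim/sd_pi_ind=> y; elim/sd_pi_ind=> z.
by rewrite !sdE; apply/sd_piP/sd_addA.
Qed.

Fact sd_addrC : commutative sd_add.
Proof.
elim/sd_pi_ind=> x; elim/sd_pi_ind=> y.
by rewrite !sdE; apply/sd_piP/sd_addC.
Qed.

Fact sd_add0r : left_id (sd_pi (Cst 0)) sd_add.
Proof. by elim/sd_pi_ind=> x; rewrite !sdE; apply/sd_piP/sd_add0. Qed.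

Fact sd_scale1 : left_id 1 sd_scale.
Proof. by elim/sd_pi_ind=> x; rewrite !sdE; apply/sd_piP/sd_mul1. Qed.

Fact sd_scaleDl u : {morph sd_scale^~ u : a b / a + b >-> sd_add a b}.
Proof.
elim/sd_pi_ind: u => x a b; rewrite !sdE; apply/sd_piP.
apply: sd_eq_trans (sd_mulDl _ _ _).
by apply: sd_eqM (sd_eq_refl _); apply: sd_cstD.
Qed.

Fact sd_addNr : left_inverse (sd_pi (Cst 0)) (sd_scale (-1)) sd_add.
Proof.
move=> u; rewrite -{2}[u]sd_scale1 -sd_scaleDl addNr.
by elim/sd_pi_ind: u => x; rewrite sdE; apply/sd_piP/sd_mul0.
Qed.

HB.instance Definition _ :=
  GRing.isZmodule.Build SD sd_addrA sd_addrC sd_add0r sd_addNr.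

Lemma sd_piD x y : sd_pi x + sd_pi y = sd_pi (Add x y).
Proof. exact: sd_addE. Qed.

Fact sd_mulrA : associative sd_mul.
Proof.
elim/sd_pi_ind=> x; elim/sd_pi_ind=> y; elim/sd_pi_ind=> z.
by rewrite !sdE; apply/sd_piP/sd_mulA.
Qed.

Fact sd_mul1r : left_id (sd_pi (Cst 1)) sd_mul.
Proof. by elim/sd_pi_ind=> x; rewrite !sdE; apply/sd_piP/sd_mul1. Qed.

Fact sd_mulr1 : right_id (sd_pi (Cst 1)) sd_mul.
Proof.
elim/sd_pi_ind=> x; rewrite !sdE; apply/sd_piP.
by apply: sd_eq_trans (sd_eq_sym (sd_cstC _ _)) (sd_mul1 _).
Qed.

Fact sd_mulrDl : left_distributive sd_mul +%R.
Proof.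
elim/sd_pi_ind=> x; elim/sd_pi_ind=> y; elim/sd_pi_ind=> z.
by rewrite !(sdE, sd_piD); apply/sd_piP/sd_mulDl.
Qed.

Fact sd_mulrDr : right_distributive sd_mul +%R.
Proof.
elim/sd_pi_ind=> x; elim/sd_pi_ind=> y; elim/sd_pi_ind=> z.
by rewrite !(sdE, sd_piD); apply/sd_piP/sd_mulDr.
Qed.

(* SD is nonzero because it acts on the K-valued functions on Z x {0, 1},
   viewed as formal series in the monomials t^n theta^i. *)
Let series := int * bool -> K.

Fixpoint sd_eval (x : sd_term) (f : series) : series :=
  match x with
  | Gen gT => fun p => f (p.1 - 1, p.2)
  | Gen gTinv => fun p => f (p.1 + 1, p.2)
  | Gen gDt => fun p => (p.1 + 1)%:~R * f (p.1 + 1, p.2)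
  | Gen gTh => fun p => if p.2 then f (p.1, false) else 0
  | Gen gDth => fun p => if p.2 then 0 else f (p.1, true)
  | Cst a => fun p => a * f p
  | Add y z => fun p => sd_eval y f p + sd_eval z f p
  | Mul y z => sd_eval y (sd_eval z f)
  end.

Lemma sd_eval_ext x f g : f =1 g -> sd_eval x f =1 sd_eval x g.
Proof. by move/funext->. Qed.

Lemma sd_evalP x a f g p :
  sd_eval x (fun q => a * f q + g q) p = a * sd_eval x f p + sd_eval x g p.
Proof.
elim: x f g p => [[]|c|x IHx y IHy|x IHx y IHy] f g [n i] //=.
- by ring.
- by case: i => //; rewrite mulr0 addr0.
- by case: i => //; rewrite mulr0 addr0.
- by ring.
- by rewrite IHx IHy; ring.
- rewrite -IHx; apply: sd_eval_ext => q; exact: IHy.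
Qed.

Lemma sd_eval_eq x y : sd_eq x y -> forall f, sd_eval x f =1 sd_eval y f.
Proof.
elim=> {x y} //=.
- move=> x y [] //= => [f [n i]|f [n i]|f [n i]|f [n []]|f [n []]|f [n []]|g h].
  + by rewrite subrK mul1r.
  + by rewrite addrK mul1r.
  + by rewrite /= addrK subrK mul1r rmorphD /=; ring.
  + by rewrite mul1r add0r.
  + by rewrite mul1r addr0.
  + by rewrite mul0r.
  + by rewrite mul0r.
  + by rewrite mul0r.
  + by rewrite mul0r.
  by case: g h => [] [] //= _ _ f [n []] //=; rewrite mulr0.
- by move=> x y _ IH f p; rewrite IH.
- by move=> y x z _ IHx _ IHy f p; rewrite IHx IHy.
- by move=> x x' y y' _ IHx _ IHy f p; rewrite IHx IHy.
- by move=> x x' y y' _ IHx _ IHy f p; rewrite IHx; apply: sd_eval_ext.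
- by move=> x y z f p; rewrite addrA.
- by move=> x y f p; rewrite addrC.
- by move=> x f p; rewrite mul0r add0r.
- by move=> x f p; rewrite mul1r.
- by move=> x f p; rewrite !mul0r.
- move=> x y z f p; rewrite -[sd_eval x (sd_eval y f) p]mul1r -sd_evalP.
  by apply: sd_eval_ext => q; rewrite mul1r.
- by move=> a b f p; rewrite mulrDl.
- by move=> a b f p; rewrite mulrA.
move=> a x f p.
have := sd_evalP x a f (fun=> 0) p.
have -> : sd_eval x (fun=> 0) p = 0.
  rewrite -[RHS](addNr (sd_eval x (fun=> 0) p)) -mulN1r -sd_evalP.
  by apply: sd_eval_ext => q; rewrite mulr0 addr0.
by rewrite addr0 => <-; apply: sd_eval_ext => q; rewrite addr0.
Qed.

Fact sd_oner_neq0 : sd_pi (Cst 1) != 0.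
Proof.
apply/eqP => /sd_piP/sd_eval_eq/(_ (fun=> 1) (0, false)) /=.
by rewrite mul1r mul0r => /eqP; rewrite oner_eq0.
Qed.

HB.instance Definition _ := GRing.Zmodule_isNzRing.Build SD
  sd_mulrA sd_mul1r sd_mulr1 sd_mulrDl sd_mulrDr sd_oner_neq0.

Fact sd_scaleA a b u : sd_scale a (sd_scale b u) = sd_scale (a * b) u.
Proof.
elim/sd_pi_ind: u => x; rewrite !sdE; apply/sd_piP.
apply: sd_eq_trans (sd_mulA _ _ _) _.
by apply: sd_eqM (sd_eq_refl _); apply/sd_eq_sym/sd_cstM.
Qed.

Fact sd_scaleDr : right_distributive sd_scale +%R.
Proof.
move=> a; elim/sd_pi_ind=> x; elim/sd_pi_ind=> y.
by rewrite !(sdE, sd_piD); apply/sd_piP/sd_mulDr.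
Qed.

HB.instance Definition _ := GRing.Zmodule_isLmodule.Build K SD
  sd_scaleA sd_scale1 sd_scaleDr sd_scaleDl.

Lemma sd_piM x y : sd_pi x * sd_pi y = sd_pi (Mul x y).
Proof. exact: sd_mulE. Qed.

Lemma sd_piZ a x : a *: sd_pi x = sd_pi (Mul (Cst a) x).
Proof. exact: sd_scaleE. Qed.

Fact sd_scaleAl (a : K) (u v : SD) : a *: (u * v) = (a *: u) * v.
Proof.
elim/sd_pi_ind: u => x; elim/sd_pi_ind: v => y.
by rewrite sd_piM !sd_piZ sd_piM; apply/sd_piP/sd_mulA.
Qed.

HB.instance Definition _ := GRing.Lmodule_isLalgebra.Build K SD sd_scaleAl.

Fact sd_scaleAr (a : K) (u v : SD) : a *: (u * v) = u * (a *: v).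
Proof.
elim/sd_pi_ind: u => x; elim/sd_pi_ind: v => y.
rewrite sd_piM !sd_piZ sd_piM; apply/sd_piP.
apply: sd_eq_trans (sd_mulA _ _ _) _.
apply: sd_eq_trans (sd_eqM (sd_cstC _ _) (sd_eq_refl _)) _.
exact/sd_eq_sym/sd_mulA.
Qed.

HB.instance Definition _ := GRing.Lalgebra_isAlgebra.Build K SD sd_scaleAr.

Inductive sd_hterm : bool -> sd_term -> Prop :=
  | hGen g : sd_hterm (gen_odd g) (Gen g)
  | hCst a : sd_hterm false (Cst a)
  | hZero i : sd_hterm i (Cst 0)
  | hAdd i x y : sd_hterm i x -> sd_hterm i y -> sd_hterm i (Add x y)
  | hMul i j x y :
      sd_hterm i x -> sd_hterm j y -> sd_hterm (i (+) j) (Mul x y).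

Definition sd_homog i (u : SD) := exists2 x, sd_hterm i x & u = sd_pi x.

Fact sd_homog0 i : sd_homog i 0.
Proof. by exists (Cst 0) => //; apply: hZero. Qed.

Fact sd_homogP i (a : K) u v :
  sd_homog i u -> sd_homog i v -> sd_homog i (a *: u + v).
Proof.
move=> [x hx ->] [y hy ->]; exists (Add (Mul (Cst a) x) y).
  by apply: hAdd hy; apply: (hMul (hCst a) hx).
by rewrite sd_piZ sd_piD.
Qed.

Fact sd_homogM i j u v :
  sd_homog i u -> sd_homog j v -> sd_homog (i (+) j) (u * v).
Proof.
move=> [x hx ->] [y hy ->]; exists (Mul x y); first exact: hMul.
by rewrite sd_piM.
Qed.

Let sd_homogD i u v : sd_homog i u -> sd_homog i v -> sd_homog i (u + v).
Proof. by rewrite -{2}[u]scale1r; apply: sd_homogP. Qed.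

Fact sd_homog_sum u : exists u0 u1 : SD,
  [/\ sd_homog false u0, sd_homog true u1 & u = u0 + u1].
Proof.
elim/sd_pi_ind: u; elim=> [g|a|x [u0 [u1 [h0 h1 e]]] y [v0 [v1 [k0 k1 f]]]|
    x [u0 [u1 [h0 h1 e]]] y [v0 [v1 [k0 k1 f]]]].
- have hg : sd_homog (gen_odd g) (sd_pi (Gen g)) by eexists; first exact: hGen.
  case: (gen_odd g) hg => hg.
    by exists 0, (sd_pi (Gen g)); rewrite add0r; split=> //; apply: sd_homog0.
  by exists (sd_pi (Gen g)), 0; rewrite addr0; split=> //; apply: sd_homog0.
- exists (sd_pi (Cst a)), 0; rewrite addr0; split=> //.
    by exists (Cst a) => //; apply: hCst.
  exact: sd_homog0.
- exists (u0 + v0), (u1 + v1); split; try exact: sd_homogD.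
  by rewrite -sd_piD e f addrACA.
exists (u0 * v0 + u1 * v1), (u0 * v1 + u1 * v0); split.
- by apply: sd_homogD; [apply: (sd_homogM h0 k0)|apply: (sd_homogM h1 k1)].
- by apply: sd_homogD; [apply: (sd_homogM h0 k1)|apply: (sd_homogM h1 k0)].
rewrite -sd_piM e f mulrDl !mulrDr.
by rewrite -!addrA; congr (_ + _); rewrite addrA addrC.
Qed.

Fixpoint sd_sgn (x : sd_term) : sd_term :=
  match x with
  | Gen g => Mul (Cst ((-1) ^+ gen_odd g)) (Gen g)
  | Cst a => Cst a
  | Add y z => Add (sd_sgn y) (sd_sgn z)
  | Mul y z => Mul (sd_sgn y) (sd_sgn z)
  end.

Lemma sd_sgn_homog i x :
  sd_hterm i x -> sd_pi (sd_sgn x) = (-1) ^+ i *: sd_pi x.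
Proof.
elim=> {i x} [g|a|i|i x y _ IHx _ IHy|i j x y _ IHx _ IHy] /=.
- by rewrite sd_piZ.
- by rewrite expr0 scale1r.
- by rewrite [sd_pi (Cst 0)]/(0 : SD) scaler0.
- by rewrite -!sd_piD IHx IHy scalerDr.
rewrite -!sd_piM IHx IHy.
by rewrite -scalerAl -scalerAr scalerA signr_addb.
Qed.

Lemma sd_sgn_eq x y : sd_eq x y -> sd_eq (sd_sgn x) (sd_sgn y).
Proof.
elim=> {x y} /=; try by constructor.
- move=> x y hxy; apply/sd_piP.
  have [i hx hy] : exists2 i, sd_hterm i x & sd_hterm i y.
    case: hxy => [||||||g h _ _].
    + exists false; last exact: hCst.
      exact: (hMul (hGen gT) (hGen gTinv)).
    + exists false; last exact: hCst.
      exact: (hMul (hGen gTinv) (hGen gT)).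
    + exists false; first exact: (hMul (hGen gDt) (hGen gT)).
      by apply: hAdd (hCst _); apply: (hMul (hGen gT) (hGen gDt)).
    + exists false; last exact: hCst.
      apply: hAdd; first exact: (hMul (hGen gDth) (hGen gTh)).
      exact: (hMul (hGen gTh) (hGen gDth)).
    + exists false; last exact: hCst.
      exact: (hMul (hGen gTh) (hGen gTh)).
    + exists false; last exact: hCst.
      exact: (hMul (hGen gDth) (hGen gDth)).
    exists (gen_odd g (+) gen_odd h); first exact: (hMul (hGen g) (hGen h)).
    by rewrite addbC; apply: (hMul (hGen h) (hGen g)).
  rewrite (sd_sgn_homog hx) (sd_sgn_homog hy); congr (_ *: _).
  exact/sd_piP/sd_eq_rel.
- move=> y x z _ hxy _ hyz; exact: sd_eq_trans hxy hyz.
Qed.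

Fact sd_homog_direct u : sd_homog false u -> sd_homog true u -> u = 0.
Proof.
move=> [x hx ->] [y hy exy]; rewrite exy.
have : sd_pi (sd_sgn x) = sd_pi (sd_sgn y) by apply/sd_piP/sd_sgn_eq/sd_piP.
rewrite (sd_sgn_homog hx) (sd_sgn_homog hy) exy expr0 expr1 scale1r scaleN1r.
move=> /eqP; rewrite -subr_eq0 opprK -[sd_pi y + _]mulr2n -scaler_nat.
by rewrite scaler_eq0 pnatr_eq0 => /eqP.
Qed.

HB.instance Definition _ := isSuper.Build K SD
  sd_homog0 sd_homogP sd_homog_sum sd_homog_direct.
HB.instance Definition _ := Super_isAlgebra.Build K SD sd_homogM.

End WeylSuperalgebra.

Definition sd_t K : SD K := sd_pi (Gen K gT).
Definition sd_tinv K : SD K := sd_pi (Gen K gTinv).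
Definition sd_dt K : SD K := sd_pi (Gen K gDt).
Definition sd_th K : SD K := sd_pi (Gen K gTh).
Definition sd_dth K : SD K := sd_pi (Gen K gDth).

Definition sd_tpow K (m : int) : SD K :=
  match m with Posz n => sd_t K ^+ n | Negz n => sd_tinv K ^+ n.+1 end.

Definition sd_D K : SD K := sd_t K * sd_dt K.

(* The boolean e stands for 2 epsilon. *)
Definition sv_eps (K : numFieldType) (e : bool) : K := e%:R / 2.

(* [BL m] is the label of L_m, and [BG k] that of G_p with p = k + epsilon. *)
Variant sv_basis (e : bool) := BL of int | BG of int.
Arguments BL {e} _.
Arguments BG {e} _.

Definition sv_odd e (x : sv_basis e) := if x is BG _ then true else false.

Section BasisChoice.
Variable e : bool.

Definition sv_code (x : sv_basis e) : int + int :=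
  match x with BL m => inl m | BG k => inr k end.

Definition sv_decode (c : int + int) : sv_basis e :=
  match c with inl m => BL m | inr k => BG k end.

Lemma sv_codeK : cancel sv_code sv_decode. Proof. by case. Qed.

HB.instance Definition _ := Choice.copy (sv_basis e) (can_type sv_codeK).
End BasisChoice.

Section LinearExtension.
Variables (K : numFieldType) (B : choiceType) (W : lmodType K).

Definition malg_ext (F : B -> W) (u : {malg K[B]}) : W :=
  \sum_(x <- msupp u) u@_x *: F x.

Lemma malg_extEw F (u : {malg K[B]}) (d : {fset B}) : (msupp u `<=` d)%fset ->
  malg_ext F u = \sum_(x <- d) u@_x *: F x.
Proof.
move=> sud; apply: big_fset_incl => // x _ /mcoeff_outdom ->.
by rewrite scale0r.
Qed.

Lemma malg_ext_linear F : linear (malg_ext F).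
Proof.
move=> a u v; pose d := (msupp u `|` msupp v `|` msupp (a *: u + v))%fset.
rewrite !(@malg_extEw F _ d); try by apply/fsubsetP => x; rewrite !inE => ->;
  rewrite ?orbT.
rewrite scaler_sumr -big_split /=; apply: eq_bigr => x _.
by rewrite mcoeffD mcoeffZ scalerDl scalerA.
Qed.

Lemma malg_extU F x : malg_ext F << x >> = F x.
Proof.
rewrite /malg_ext msuppU oner_eq0 big_seq_fset1.
by rewrite mcoeffUU scale1r.
Qed.

Lemma malg_ext_linearF (F G : B -> W) (a : K) u :
  malg_ext (fun x => a *: F x + G x) u = a *: malg_ext F u + malg_ext G u.
Proof.
rewrite /malg_ext scaler_sumr -big_split /=; apply: eq_bigr => x _.
by rewrite scalerDr !scalerA mulrC.
Qed.

Lemma malgUZ (x : B) (a : K) : << a *g x >> = a *: << x >> :> {malg K[B]}.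
Proof. by apply/malgP => y; rewrite mcoeffZ !mcoeffU mulrnAr mulr1. Qed.

Lemma malg_ind (P : {malg K[B]} -> Prop) u : P 0 ->
  (forall a v w, P v -> P w -> P (a *: v + w)) ->
  (forall x, u@_x != 0 -> P << x >>) -> P u.
Proof.
move=> P0 PZ PU; rewrite [u]monalgE.
suff H (s : seq B) : {subset s <= msupp u} ->
    P (\sum_(x <- s) << u@_x *g x >>) by apply: H.
elim: s => [|x s IH] sub; first by rewrite big_nil.
rewrite big_cons malgUZ; apply: PZ.
  by apply: PU; rewrite mcoeff_neq0; apply: sub; rewrite mem_head.
by apply: IH => y ys; apply: sub; rewrite inE ys orbT.
Qed.

End LinearExtension.

Section JacobiBasis.
Variables (K : numFieldType) (V : lmodType K) (br : V -> V -> V).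
Variables (L G : int -> V) (e : nat) (eps : K).
Hypothesis eE : (Posz e)%:~R = 2 * eps.
Hypothesis brZl : forall a u v, br (a *: u) v = a *: br u v.
Hypothesis brZr : forall a u v, br u (a *: v) = a *: br u v.
Let c (m k : int) : K := m%:~R / 2 - (k%:~R + eps).
Hypothesis brLL : forall m n, br (L m) (L n) = (m - n)%:~R *: L (m + n).
Hypothesis brLG : forall m k, br (L m) (G k) = c m k *: G (m + k).
Hypothesis brGL : forall m k, br (G k) (L m) = - c m k *: G (m + k).
Hypothesis brGG : forall k l, br (G k) (G l) = 2 *: L (k + l + e).

Let brE := (brLL, brLG, brGL, brGG, brZl, brZr, scalerA).

Let lin (X : int -> V) p q r (a b d : K) :
  p = q -> p = r -> a = b + d -> a *: X p = b *: X q + d *: X r.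
Proof. by move=> <- <- ->; rewrite scalerDl. Qed.

Lemma jacobi_basis (i j k : bool) (l m n : int) :
  let B (i : bool) := if i then G else L in
  br (B i l) (br (B j m) (B k n)) =
    br (br (B i l) (B j m)) (B k n) +
    (-1) ^+ (i && j) *: br (B j m) (br (B i l) (B k n)).
Proof.
case: i j k => [] [] [] /=; rewrite !brE ?expr0 ?expr1 ?mul1r ?scale1r.
all: apply: lin; [lia|lia|].
all: rewrite /c ?(rmorphD, rmorphB, rmorphN) /= ?eE; by field.
Qed.

End JacobiBasis.
Section SuperVirasoro.
Variables (K : numFieldType) (e : bool).

Definition svir : Type := {malg K[sv_basis e]}.
HB.instance Definition _ := GRing.Lmodule.on svir.

Definition sv_L (m : int) : svir := << BL m >>.
Definition sv_G (k : int) : svir := << BG k >>.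

(* For p = k + epsilon, q = l + epsilon: m + p = (m + k) + epsilon and
   p + q = k + l + 2 epsilon. *)
Definition sv_lie_basis (x y : sv_basis e) : svir :=
  match x, y with
  | BL m, BL n => (m - n)%:~R *: sv_L (m + n)
  | BL m, BG k => (m%:~R / 2 - (k%:~R + sv_eps K e)) *: sv_G (m + k)
  | BG k, BL m => - (m%:~R / 2 - (k%:~R + sv_eps K e)) *: sv_G (m + k)
  | BG k, BG l => 2 *: sv_L (k + l + e)
  end.

(* Locked, to keep unification from unfolding it. *)
Definition sv_lie_def (u v : svir) : svir :=
  malg_ext (fun x => malg_ext (sv_lie_basis x) v) u.
Fact sv_lie_key : unit. Proof. by []. Qed.
Definition sv_lie := locked_with sv_lie_key sv_lie_def.
Canonical sv_lie_unlock := [unlockable fun sv_lie].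

Definition sv_homog (i : bool) (u : svir) :=
  forall x, u@_x != 0 -> sv_odd x = i.

Fact sv_homog0 i : sv_homog i 0.
Proof. by move=> x; rewrite mcoeff0 eqxx. Qed.

Fact sv_homogP i (a : K) (u v : svir) :
  sv_homog i u -> sv_homog i v -> sv_homog i (a *: u + v).
Proof.
move=> hu hv x; rewrite mcoeffD mcoeffZ => auv.
have [u0|/hu //] := eqVneq (u@_x) 0.
by apply: hv; apply: contraNneq auv => ->; rewrite u0 mulr0 addr0.
Qed.

Lemma sv_homogU x : sv_homog (sv_odd x) << x >>.
Proof. by move=> y; rewrite mcoeffU; case: (x =P y) => [->|_] //; rewrite eqxx. Qed.

Let sv_homogZ i (a : K) (u : svir) : sv_homog i u -> sv_homog i (a *: u).
Proof. by move=> hu; rewrite -[_ *: _]addr0; apply: sv_homogP (@sv_homog0 i). Qed.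

Let sv_homogD i (u v : svir) :
  sv_homog i u -> sv_homog i v -> sv_homog i (u + v).
Proof. by rewrite -{2}[u]scale1r; apply: sv_homogP. Qed.

Fact sv_homog_sum u : exists u0 u1 : svir,
  [/\ sv_homog false u0, sv_homog true u1 & u = u0 + u1].
Proof.
apply: (@malg_ind _ _ (fun u : svir => exists u0 u1 : svir,
  [/\ sv_homog false u0, sv_homog true u1 & u = u0 + u1])).
- by exists 0, 0; rewrite addr0; split=> //; apply: sv_homog0.
- move=> a v w [v0 [v1 [h0 h1 ->]]] [w0 [w1 [k0 k1 ->]]].
  exists (a *: v0 + w0), (a *: v1 + w1); split; try exact: sv_homogP.
  by rewrite scalerDr addrACA.
move=> x _; case ox: (sv_odd x); have := @sv_homogU x; rewrite ox => hx.
  by exists 0, << x >>; rewrite add0r; split=> //; apply: sv_homog0.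
by exists << x >>, 0; rewrite addr0; split=> //; apply: sv_homog0.
Qed.

Fact sv_homog_direct u : sv_homog false u -> sv_homog true u -> u = 0.
Proof.
move=> h0 h1; apply/malgP => x; rewrite mcoeff0; apply/eqP.
by apply: contraT => ux; have := h0 x ux; rewrite (h1 x ux).
Qed.

HB.instance Definition _ := isSuper.Build K svir
  sv_homog0 sv_homogP sv_homog_sum sv_homog_direct.

Fact sv_lie_linearl z : linear (sv_lie^~ z).
Proof. by move=> a u v; rewrite unlock; apply: malg_ext_linear. Qed.

Fact sv_lie_linearr z : linear (sv_lie z).
Proof.
move=> a u v; rewrite unlock -malg_ext_linearF.
by congr malg_ext; apply/funext => x; apply: malg_ext_linear.
Qed.

Lemma sv_lieU x y : sv_lie << x >> << y >> = sv_lie_basis x y.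
Proof. by rewrite unlock /sv_lie_def !malg_extU. Qed.

Lemma sv_homog_ind i (P : svir -> Prop) : P 0 ->
  (forall a v w, P v -> P w -> P (a *: v + w)) ->
  (forall x, sv_odd x = i -> P << x >>) -> forall u, sv_homog i u -> P u.
Proof. by move=> P0 PZ PU u hu; apply: malg_ind => // x /hu; apply: PU. Qed.

HB.instance Definition _ z :=
  GRing.isLinear.Build K svir svir _ (sv_lie z) (sv_lie_linearr z).
Let lie0l z : sv_lie 0 z = 0.
Proof. by rewrite unlock /sv_lie_def /malg_ext msupp0 big_seq_fset0. Qed.
Let lieNl u z : sv_lie (- u) z = - sv_lie u z.
Proof.
by have := sv_lie_linearl z (-1) u 0; rewrite lie0l !addr0 !scaleN1r.
Qed.
Let lieZl a u z : sv_lie (a *: u) z = a *: sv_lie u z.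
Proof. by have := sv_lie_linearl z a u 0; rewrite lie0l !addr0. Qed.

Let lieDZl z a u v :
  sv_lie (a *: u + v) z = a *: sv_lie u z + sv_lie v z.
Proof. exact: sv_lie_linearl. Qed.
Let lieDZr z a u v :
  sv_lie z (a *: u + v) = a *: sv_lie z u + sv_lie z v.
Proof. exact: sv_lie_linearr. Qed.
Let lieNr u z : sv_lie u (- z) = - sv_lie u z.
Proof. exact: linearN. Qed.
Let lieZr a u z : sv_lie u (a *: z) = a *: sv_lie u z.
Proof. exact: linearZ. Qed.

Let sv_basisE (x : sv_basis e) :
  << x >> = (if sv_odd x then sv_G else sv_L)
              (match x with BL m => m | BG k => k end).
Proof. by case: x. Qed.

Fact sv_homog_lie i j u v :
  sv_homog i u -> sv_homog j v -> sv_homog (i (+) j) (sv_lie u v).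
Proof.
move=> hu hv; move: u hu; apply: sv_homog_ind.
- by rewrite lie0l; apply: sv_homog0.
- by move=> a u w IHu IHw; rewrite sv_lie_linearl; apply: sv_homogP.
move=> x <-; move: v hv; apply: sv_homog_ind.
- by rewrite linear0; apply: sv_homog0.
- by move=> a u w IHu IHw; rewrite sv_lie_linearr; apply: sv_homogP.
move=> y <-; rewrite sv_lieU; case: x y => [m|k] [n|l] /=;
  rewrite -?scaleNr; apply: sv_homogZ; exact: sv_homogU.
Qed.

Fact sv_lie_skew i j u v : sv_homog i u -> sv_homog j v ->
  sv_lie u v = - ((-1) ^+ (i && j) *: sv_lie v u).
Proof.
move=> hu hv; move: u hu; apply: sv_homog_ind.
- by rewrite lie0l linear0 scaler0 oppr0.
- move=> a u w IHu IHw; rewrite sv_lie_linearl IHu IHw sv_lie_linearr.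
  by rewrite scalerDr opprD scalerN !scalerA mulrC.
move=> x <-; move: v hv; apply: sv_homog_ind.
- by rewrite lie0l linear0 scaler0 oppr0.
- move=> a u w IHu IHw; rewrite sv_lie_linearr IHu IHw sv_lie_linearl.
  by rewrite scalerDr opprD scalerN !scalerA mulrC.
move=> y <-; rewrite !sv_lieU; case: x y => [m|k] [n|l] /=.
- by rewrite expr0 scale1r -scaleNr -rmorphN opprB [n + m]addrC.
- by rewrite expr0 scale1r scaleNr opprK.
- by rewrite expr0 scale1r scaleNr.
by rewrite expr1 scaleN1r opprK [l + k]addrC.
Qed.

Fact sv_lie_jacobi i j k u v w :
  sv_homog i u -> sv_homog j v -> sv_homog k w ->
  sv_lie u (sv_lie v w) =
    sv_lie (sv_lie u v) w + (-1) ^+ (i && j) *: sv_lie v (sv_lie u w).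
Proof.
move=> hu hv hw; move: u hu; apply: sv_homog_ind.
- by rewrite !lie0l linear0 scaler0 addr0.
- move=> a u z IHu IHz; rewrite !lieDZl lieDZr IHu IHz.
  by rewrite !scalerDr !scalerA addrACA [a * _]mulrC.
move=> x <-; move: v hv; apply: sv_homog_ind.
- by rewrite linear0 !lie0l linear0 scaler0 addr0.
- move=> a u z IHu IHz; rewrite lieDZr !lieDZl lieDZr IHu IHz.
  by rewrite !scalerDr !scalerA addrACA [a * _]mulrC.
move=> y <-; move: w hw; apply: sv_homog_ind.
- by rewrite !linear0 addr0.
- move=> a u z IHu IHz; rewrite !lieDZr IHu IHz.
  by rewrite !scalerDr !scalerA addrACA [a * _]mulrC.
move=> z _; rewrite !sv_basisE.
apply: (@jacobi_basis K svir sv_lie sv_L sv_G e (sv_eps K e)) => *;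
  rewrite ?(lieZl, lieZr, sv_lieU) //.
by rewrite /sv_eps mulrCA divff ?mulr1 // pnatr_eq0.
Qed.

HB.instance Definition _ := Super_isLie.Build K svir
  sv_lie_linearl sv_lie_linearr sv_homog_lie sv_lie_skew sv_lie_jacobi.

End SuperVirasoro.

(* Main.v *)
Require Import Defs.
From HB Require Import structures.
From mathcomp Require Import all_boot all_order all_algebra.
From mathcomp Require Import boolp reals complex.
From mathcomp Require Import monalg ring zify.

Set Implicit Arguments.
Unset Strict Implicit.
Unset Printing Implicit Defensive.

Import Order.TTheory GRing.Theory Num.Theory.
Local Open Scope ring_scope.
Local Open Scope complex_scope.

(** The formulas define an even linear map from the super-Virasoro algebra to
    SD itself, and the theorem says that this map is a homomorphism for the
    supercommutator of SD ([sv_to_sdM]). The functor is then restriction of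
    scalars along it ([pull_action], [pull_functor]), which leaves the
    underlying space and the morphisms unchanged.

    The bracket relations rest on one observation: each generator has the form
    - t^m U or t^k V, where U = D + a + c theta d_theta and
    V = theta (D + a) - t^(2 epsilon) d_theta move past powers of t with a
    simple correction, namely U t^n = t^n (U + n) and
    V t^n = t^n (V + n theta). The supercommutator of two generators is
    therefore a power of t times the supercommutator of their second factors
    plus correction terms, and it remains to compare scalar coefficients. These
    computations ([weyl_LL], [weyl_LG], [weyl_GG]) take place in any algebra
    whose elements satisfy the relations between t^n, D, theta and d_theta. *)

Arguments homogM {K s i j x y}.

(** * Bracket computations in an algebra with Weyl-type relations *)

(** Here [T n], [th] and [et] stand for t^n, theta and d_theta. *)
Section WeylRelations.
Variables (K : numFieldType) (A : algType K).
Variables (T : int -> A) (D th et : A).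
Hypothesis TD : forall m n, T (m + n) = T m * T n.
Hypothesis DT : forall n, D * T n = T n * D + n%:~R *: T n.
Hypothesis thT : forall n, th * T n = T n * th.
Hypothesis etT : forall n, et * T n = T n * et.
Hypothesis thD : th * D = D * th.
Hypothesis etD : et * D = D * et.
Hypothesis thth : th * th = 0.
Hypothesis etet : et * et = 0.
Hypothesis etth : et * th = 1 - th * et.

Let E := th * et.

(** The even generators have the form [- (T m * weyl_even a c)]. *)
Definition weyl_even (a c : K) : A := D + a%:A + c *: (th * et).

(** The odd generators have the form [T k * weyl_odd e a], where e stands for
    2 epsilon. *)
Definition weyl_odd (e : int) (a : K) : A := th * D + a *: th - T e * et.

Local Notation U := weyl_even.
Local Notation V := weyl_odd.

Let ET n : E * T n = T n * E.
Proof. by rewrite /E -mulrA etT mulrA thT mulrA. Qed.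

Let ED : E * D = D * E.
Proof. by rewrite /E -mulrA etD mulrA thD mulrA. Qed.

Let thE : th * E = 0.
Proof. by rewrite /E mulrA thth mul0r. Qed.

Let Eth : E * th = th.
Proof. by rewrite /E -mulrA etth mulrBr mulr1 thE subr0. Qed.

Let etE : et * E = et.
Proof. by rewrite /E mulrA etth mulrBl mul1r -mulrA etet mulr0 subr0. Qed.

Let Eet : E * et = 0.
Proof. by rewrite /E -mulrA etet mulr0. Qed.

Lemma weyl_evenT a c n : U a c * T n = T n * (U a c + n%:~R%:A).
Proof.
rewrite /U !mulrDl !mulrDr DT -!scalerAl -!scalerAr mul1r mulr1 ET.
by rewrite -!addrA; congr (_ + _); rewrite addrC -!addrA.
Qed.

Lemma weyl_oddT e a n : V e a * T n = T n * (V e a + n%:~R *: th).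
Proof.
rewrite /V !(mulrDl, mulrDr, mulNr, mulrN) -!scalerAl -!scalerAr thT.
rewrite -[th * D * _]mulrA DT mulrDr -scalerAr !mulrA thT.
rewrite -[T e * et * T n]mulrA etT mulrA -TD [e + n]addrC TD.
by rewrite -!addrA; congr (_ + _); rewrite addrC -!addrA.
Qed.

(** Linear combinations of three fixed elements, on which identities reduce to
    identities between coefficients. *)
Let comb (u v w : A) (x y z : K) : A := x *: u + y *: v + z *: w.

Let combD u v w x y z x' y' z' :
  comb u v w x y z + comb u v w x' y' z' =
  comb u v w (x + x') (y + y') (z + z').
Proof. by rewrite /comb !scalerDl addrACA; congr (_ + _); rewrite addrACA. Qed.

Let combZ u v w a x y z :
  a *: comb u v w x y z = comb u v w (a * x) (a * y) (a * z).
Proof. by rewrite /comb !scalerDr !scalerA. Qed.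

Let combN u v w x y z : - comb u v w x y z = comb u v w (- x) (- y) (- z).
Proof. by rewrite -scaleN1r combZ !mulN1r. Qed.

Let UE a c : U a c = comb D 1 E 1 a c.
Proof. by rewrite /comb scale1r. Qed.

Let VE e a : V e a = comb (th * D) th (T e * et) 1 a (-1).
Proof. by rewrite /comb scale1r scaleN1r. Qed.

Lemma weyl_even_comm a c a' c' : GRing.comm (U a c) (U a' c').
Proof.
have comm1 (x : A) y : GRing.comm x y%:A.
  by rewrite /GRing.comm mulr_algl mulr_algr.
have commZ (x y : A) z : GRing.comm x y -> GRing.comm x (z *: y).
  by rewrite /GRing.comm => xy; rewrite -scalerAl -scalerAr xy.
have commU (x : A) y z :
    GRing.comm x D -> GRing.comm x E -> GRing.comm x (U y z).
  move=> xD xE; apply: commrD; last exact: commZ.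
  by apply: commrD (comm1 _ _).
by apply: (commU); apply: commr_sym; apply: commU; rewrite // /GRing.comm ED.
Qed.

(** The bracket reduces to T (m + n) (n U' - m U), because U and U' commute;
    the coefficients of D, 1 and th et in n U' - m U are n - m and the
    left-hand sides of the two hypotheses. *)
Lemma weyl_LL m n a c a' c' a'' c'' :
  n%:~R * a' - m%:~R * a = (n - m)%:~R * a'' ->
  n%:~R * c' - m%:~R * c = (n - m)%:~R * c'' ->
  (T m * U a c) * (T n * U a' c') - (T n * U a' c') * (T m * U a c) =
  (n - m)%:~R *: (T (m + n) * U a'' c'').
Proof.
move=> ha hc; rewrite !mulrA -[_ * _ * T n]mulrA -[_ * _ * T m]mulrA.
rewrite !weyl_evenT !mulrA -!TD [n + m]addrC -!mulrA -mulrBr scalerAr.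
congr (_ * _).
rewrite (mulrDl (U a c)) (mulrDl (U a' c')) weyl_even_comm.
rewrite opprD addrACA subrr add0r !mulr_algl.
by rewrite !UE !combZ combN combD ha hc !mulr1 -rmorphB.
Qed.

Let UV a c e d :
  U a c * V e d =
  V e d * U a c + comb (th * D) th (T e * et) c (c * d) (c - e%:~R).
Proof.
have DV : D * V e d = V e d * D - e%:~R *: (T e * et).
  rewrite /V !(mulrDl, mulrDr, mulNr, mulrN) -!scalerAl -!scalerAr.
  by rewrite !mulrA -thD DT mulrDl -!mulrA etD -scalerAl opprD !addrA.
have EV : E * V e d = th * D + d *: th.
  rewrite /V !(mulrDr, mulrN) -scalerAr Eth !mulrA Eth ET.
  by rewrite -mulrA Eet mulr0 subr0.
have VmE : V e d * E = - (T e * et).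
  rewrite /V !(mulrDl, mulNr) -scalerAl -!mulrA -ED mulrA !thE etE.
  by rewrite mul0r scaler0 !add0r.
have mulUl X : U a c * X = D * X + a *: X + c *: (E * X).
  by rewrite /U !mulrDl -!scalerAl mul1r.
have mulUr X : X * U a c = X * D + a *: X + c *: (X * E).
  by rewrite /U !mulrDr -!scalerAr mulr1.
rewrite mulUl mulUr DV EV VmE [_ - _ + a *: _]addrAC -!addrA.
do 2! congr (_ + _); rewrite /comb scalerBl scalerN scalerDr scalerA.
by rewrite addrC [RHS]addrCA addKr.
Qed.

(** The three hypotheses compare the coefficients of th D, T e et and th in
    U V - V U + k V - m th U, to which the bracket reduces after T (m + k) is
    factored out; th U = th D + a th because th th = 0. *)
Lemma weyl_LG m k e a (c : K) d d' (x : K) :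
  x = k%:~R + c - m%:~R -> x = k%:~R + e%:~R - c ->
  d * (k%:~R + c) - m%:~R * a = x * d' ->
  (T m * U a c) * (T k * V e d) - (T k * V e d) * (T m * U a c) =
  x *: (T (m + k) * V e d').
Proof.
move=> hx hxe hd; rewrite !mulrA -[_ * _ * T k]mulrA -[_ * _ * T m]mulrA.
rewrite weyl_evenT weyl_oddT !mulrA -!TD [k + m]addrC -!mulrA -mulrBr scalerAr.
congr (_ * _).
rewrite (mulrDl (U a c)) (mulrDl (V e d)) UV mulr_algl -scalerAl.
have -> : th * U a c = comb (th * D) th (T e * et) 1 a 0.
  rewrite /U !mulrDr mulr_algr -scalerAr -/E thE scaler0 /comb scale0r.
  by rewrite scale1r.
rewrite -[X in X - _]addrA opprD addrACA subrr add0r VE.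
rewrite !combZ combN !combD VE combZ.
congr comb; [rewrite hx; ring|rewrite -hd; ring|rewrite hxe; ring].
Qed.

(** The D E terms of the two cross products cancel. *)
Let VV e a a' :
  V e a * V e a' =
  - (T e * comb D 1 E 1 a' (a - a' + e%:~R)).
Proof.
have Xth : th * D * th = 0 by rewrite thD -mulrA thth mulr0.
have XX : th * D * (th * D) = 0 by rewrite mulrA Xth mul0r.
have thX : th * (th * D) = 0 by rewrite mulrA thth mul0r.
have XY : th * D * (T e * et) = T e * (D * E + e%:~R *: E).
  rewrite -[LHS]mulrA [D * _]mulrA DT mulrDl -scalerAl -!mulrA -etD.
  by rewrite mulrDr -scalerAr !mulrA thT -!mulrA [th * (et * D)]mulrA -/E ED
    mulrDr -scalerAr.
have thY : th * (T e * et) = T e * E by rewrite mulrA thT -mulrA.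
have Yth : T e * et * th = T e * (1 - E) by rewrite -mulrA etth.
have YX : T e * et * (th * D) = T e * (D - D * E).
  by rewrite mulrA Yth -mulrA mulrBl mul1r ED.
have YY : T e * et * (T e * et) = 0.
  by rewrite mulrA -[T e * et * _]mulrA etT -!mulrA etet !mulr0.
rewrite /V !(mulrDl, mulrDr, mulNr, mulrN) -!scalerAl -!scalerAr.
rewrite XX Xth XY thX thth thY YX Yth YY !scaler0 !add0r !oppr0 addr0.
rewrite !scalerAr -opprD -opprD -opprD -!mulrDr; congr (- (_ * _)).
rewrite -!scalerAr -/E -[D * E + _ + _]addrA addrACA
  [D * E + _]addrC subrK scale1r.
rewrite scalerBr scalerDl scalerBl -[RHS]addrA; congr (_ + _).
by rewrite addrCA; congr (_ + _); rewrite [RHS]addrAC [a *: E + _]addrC.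
Qed.

(** After T (k + l) T e is factored out, what remains is minus the sum of
    2 D + (a + a') + 2 e th et, from V V' + V' V, and (k + l) th et, from the
    corrections. *)
Lemma weyl_GG k l e a a' b c :
  a + a' = 2 * b -> k%:~R + l%:~R + 2 * e%:~R = 2 * c ->
  (T k * V e a) * (T l * V e a') + (T l * V e a') * (T k * V e a) =
  - (2 *: (T (k + l + e) * U b c)).
Proof.
move=> ha hc; rewrite !mulrA -[_ * _ * T k]mulrA -[_ * _ * T l]mulrA.
rewrite !weyl_oddT !mulrA -!TD [l + k]addrC (TD (k + l)) -!mulrA -mulrDr.
rewrite !scalerAr -!mulrN; congr (_ * _).
have thV x : th * V e x = - (T e * comb D 1 E 0 0 1).
  rewrite /V /comb !scale0r !add0r scale1r !(mulrDr, mulrN) -scalerAr !mulrA.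
  by rewrite thth mul0r scaler0 !add0r thT -mulrA.
rewrite (mulrDl (V e a)) (mulrDl (V e a')) -!scalerAl !thV !VV.
rewrite !scalerN !scalerAr -!opprD -!mulrDr.
rewrite -!mulrN; congr (_ * _); congr (- _).
rewrite UE !combZ !combD; congr comb; rewrite -?ha -?hc; ring.
Qed.

End WeylRelations.

(** * Relations in the Weyl superalgebra *)

Section SDRelations.
Variable K : numFieldType.
Local Notation t := (sd_t K).
Local Notation tinv := (sd_tinv K).
Local Notation dt := (sd_dt K).
Local Notation th := (sd_th K).
Local Notation dth := (sd_dth K).
Local Notation D := (sd_D K).
Local Notation T := (@sd_tpow K).

Let sd_relE x y : sd_rel x y -> sd_pi x = sd_pi y :> SD K.
Proof. by move=> xy; apply/sd_piP/sd_eq_rel. Qed.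

Lemma sd_ttinv : t * tinv = 1.
Proof. by rewrite sd_piM; apply/sd_relE/rel_ttinv. Qed.

Lemma sd_tinvt : tinv * t = 1.
Proof. by rewrite sd_piM; apply/sd_relE/rel_tinvt. Qed.

Lemma sd_dtt : dt * t = t * dt + 1.
Proof. by rewrite !sd_piM [RHS]sd_piD; apply/sd_relE/rel_dtt. Qed.

Lemma sd_dthth : dth * th = 1 - th * dth.
Proof.
apply/eqP; rewrite eq_sym subr_eq eq_sym; apply/eqP.
by rewrite !sd_piM sd_piD; apply/sd_relE/rel_dthth.
Qed.

Lemma sd_thth : th * th = 0.
Proof. by rewrite sd_piM; apply/sd_relE/rel_thth. Qed.

Lemma sd_dthdth : dth * dth = 0.
Proof. by rewrite sd_piM; apply/sd_relE/rel_dthdth. Qed.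

Lemma sd_comm_gen g h : gen_odd g -> ~~ gen_odd h ->
  GRing.comm (sd_pi (Gen K g)) (sd_pi (Gen K h)).
Proof.
by move=> og eh; rewrite /GRing.comm !sd_piM; apply/sd_relE/rel_comm.
Qed.

Lemma sd_comm_tpow g n : gen_odd g -> GRing.comm (sd_pi (Gen K g)) (T n).
Proof. by move=> og; case: n => n; apply: commrX; apply: sd_comm_gen. Qed.

Lemma sd_comm_D g : gen_odd g -> GRing.comm (sd_pi (Gen K g)) D.
Proof. by move=> og; apply: commrM; apply: sd_comm_gen. Qed.

Lemma sd_tpowS n : T (n + 1) = t * T n.
Proof.
case: n => [n|[|n]]; first by rewrite /= addn1 exprS.
  by rewrite /= expr1 sd_ttinv.
have -> : Negz n.+1 + 1 = Negz n by lia.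
by rewrite /= [in RHS]exprS mulrA sd_ttinv mul1r.
Qed.

Lemma sd_tpowB1 n : T (n - 1) = tinv * T n.
Proof. by rewrite -{2}[n](subrK 1) sd_tpowS mulrA sd_tinvt mul1r. Qed.

Let int_step_ind (P : int -> Prop) : P 0 ->
  (forall n, P n -> P (n + 1)) -> (forall n, P n -> P (n - 1)) -> forall n, P n.
Proof.
move=> P0 PS PB; elim/int_ind=> [//|n IHn|n IHn].
  by rewrite -addn1 PoszD; apply: PS.
by rewrite -addn1 PoszD opprD; apply: PB.
Qed.

Lemma sd_tpowD m n : T (m + n) = T m * T n.
Proof.
elim/int_step_ind: m => [|m IHm|m IHm]; first by rewrite add0r mul1r.
  by rewrite addrAC !sd_tpowS IHm mulrA.
by rewrite addrAC !sd_tpowB1 IHm mulrA.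
Qed.

Lemma sd_D_tpow n : D * T n = T n * D + n%:~R *: T n.
Proof.
have Dt : D * t = t * D + t by rewrite /sd_D -mulrA sd_dtt mulrDr mulr1.
have Dtinv : D * tinv = tinv * D - tinv.
  rewrite -[LHS]mul1r -sd_tinvt -[LHS]mulrA [t * _]mulrA.
  have -> : t * D = D * t - t by rewrite Dt addrK.
  by rewrite mulrBl -[D * t * _]mulrA sd_ttinv mulr1 mulrBr mulr1.
elim/int_step_ind: n => [|n IHn|n IHn].
- by rewrite scale0r addr0 mulr1 mul1r.
- rewrite sd_tpowS mulrA Dt mulrDl -mulrA IHn mulrDr -scalerAr.
  by rewrite rmorphD scalerDl scale1r !mulrA addrA.
rewrite sd_tpowB1 mulrA Dtinv mulrBl -[tinv * D * T n]mulrA IHn.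
by rewrite mulrDr -scalerAr rmorphB scalerBl scale1r !mulrA addrA.
Qed.

Lemma sd_homog_gen g : homog (gen_odd g) (sd_pi (Gen K g)).
Proof. by exists (Gen K g) => //; apply: hGen. Qed.

Lemma sd_homog1 : homog false (1 : SD K).
Proof. by exists (Cst 1) => //; apply: hCst. Qed.

Lemma sd_homog_tpow n : homog false (T n).
Proof.
have homogX x k : homog false (x : SD K) -> homog false (x ^+ k).
  move=> hx; elim: k => [|k IHk]; first exact: sd_homog1.
  by rewrite exprS; apply: (homogM hx IHk).
by case: n => n; apply: homogX;
  [apply: (sd_homog_gen gT)|apply: (sd_homog_gen gTinv)].
Qed.

Lemma sd_homog_D : homog false D.
Proof. exact: (homogM (sd_homog_gen gT) (sd_homog_gen gDt)). Qed.

End SDRelations.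

(** * Linear maps and homogeneous elements *)

Section LinearFun.
Variables (K : numFieldType) (U W : lmodType K) (f : U -> W).
Hypothesis lf : linear f.

Lemma linear_fun0 : f 0 = 0.
Proof. by rewrite -[X in f X](addNr 0) -scaleN1r lf scaleN1r addNr. Qed.

Lemma linear_funN x : f (- x) = - f x.
Proof. by rewrite -[- x]addr0 -scaleN1r lf linear_fun0 addr0 scaleN1r. Qed.

End LinearFun.

Lemma homogD (K : numFieldType) (W : superspaceType K) i (u v : W) :
  homog i u -> homog i v -> homog i (u + v).
Proof. by rewrite -{2}[u]scale1r; apply: homogP. Qed.

Lemma homogZ (K : numFieldType) (W : superspaceType K) i (a : K) (u : W) :
  homog i u -> homog i (a *: u).
Proof. by move=> hu; rewrite -[_ *: _]addr0; apply: homogP (homog0 i). Qed.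

(** * The homomorphism from the super-Virasoro algebra to SD *)

Section SuperVirasoroToSD.
Variables (K : numFieldType) (e : bool) (b : K).
Local Notation th := (sd_th K).
Local Notation dth := (sd_dth K).
Local Notation D := (sd_D K).
Local Notation T := (@sd_tpow K).
Local Notation eps := (sv_eps K e).
Local Notation U := (weyl_even D th dth).
Local Notation V := (weyl_odd T D th dth e).

(** The operators by which the basis elements act, as elements of SD. Here
    [k%:~R + eps] is the index p of G_p. *)
Definition sv_to_sd_basis (x : sv_basis e) : SD K :=
  match x with
  | BL m => - (T m * U ((m%:~R - 2 * eps) * b) ((m%:~R + 2 * eps) / 2))
  | BG k => T k * V (2 * (k%:~R + eps - eps) * b)
  end.

(** The linear extension to the super-Virasoro algebra. *)
Definition sv_to_sd (u : svir K e) : SD K := malg_ext sv_to_sd_basis u.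

Lemma sv_to_sd_linear : linear sv_to_sd.
Proof. exact: malg_ext_linear. Qed.

HB.instance Definition _ :=
  GRing.isLinear.Build K (svir K e) (SD K) _ sv_to_sd sv_to_sd_linear.

Lemma sv_to_sdU x : sv_to_sd << x >> = sv_to_sd_basis x.
Proof. exact: malg_extU. Qed.

Lemma homog_sv_to_sd i u : homog i u -> homog i (sv_to_sd u).
Proof.
have hth : homog true th := sd_homog_gen K gTh.
have hdth : homog true dth := sd_homog_gen K gDth.
move: u; apply: sv_homog_ind.
- by rewrite linear0; apply: homog0.
- by move=> a u v hu hv; rewrite linearP; apply: homogP.
move=> x <-; rewrite sv_to_sdU; case: x => [m|k] /=.
  rewrite -scaleN1r; apply: homogZ; apply: (homogM (sd_homog_tpow K m)).
  apply: homogD; last by apply: homogZ; apply: (homogM hth hdth).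
  by apply: homogD (homogZ _ (sd_homog1 K)); apply: sd_homog_D.
apply: (homogM (sd_homog_tpow K k)); rewrite /weyl_odd -scaleN1r.
apply: homogD; last by apply/homogZ/(homogM (sd_homog_tpow K e) hdth).
by apply: homogD (homogZ _ hth); apply: (homogM hth (sd_homog_D K)).
Qed.

Lemma sv_to_sd_basisM x y :
  sv_to_sd (sv_lie_basis K x y) =
  sv_to_sd_basis x * sv_to_sd_basis y -
  (-1) ^+ (sv_odd x && sv_odd y) *: (sv_to_sd_basis y * sv_to_sd_basis x).
Proof.
have two0 : 2 != 0 :> K by rewrite pnatr_eq0.
have eE : (e : int)%:~R = 2 * eps by rewrite /sv_eps mulrC divfK.
have DT := @sd_D_tpow K; have TD := @sd_tpowD K.
have thT n : th * T n = T n * th by apply: (@sd_comm_tpow K gTh).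
have etT n : dth * T n = T n * dth by apply: (@sd_comm_tpow K gDth).
have thD : th * D = D * th by apply: (@sd_comm_D K gTh).
have etD : dth * D = D * dth by apply: (@sd_comm_D K gDth).
have thth := sd_thth K; have etet := sd_dthdth K; have etth := sd_dthth K.
have LG m k : sv_to_sd ((m%:~R / 2 - (k%:~R + eps)) *: sv_G K e (m + k)) =
    sv_to_sd_basis (BL m) * sv_to_sd_basis (BG k) -
    sv_to_sd_basis (BG k) * sv_to_sd_basis (BL m).
  rewrite linearZ /= sv_to_sdU /= mulNr mulrN -opprD.
  rewrite (weyl_LG (x := k%:~R + eps - m%:~R / 2)
    (d' := 2 * ((m + k)%:~R + eps - eps) * b)
    TD DT thT etT thD etD thth etet etth).
  - by rewrite -scaleNr opprB.
  - by field.
  - by rewrite eE; field.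
  by rewrite rmorphD /=; field.
case: x y => [m|k] [n|l] /=.
- rewrite expr0 scale1r mulrNN mulrNN.
  rewrite (weyl_LL (a'' := ((m + n)%:~R - 2 * eps) * b)
    (c'' := ((m + n)%:~R + 2 * eps) / 2) TD DT thT etT thD etD).
  + by rewrite linearZ /= sv_to_sdU /= scalerN -scaleNr -rmorphN opprB.
  + by rewrite !(rmorphD, rmorphN) /=; ring.
  by rewrite !(rmorphD, rmorphN) /=; field.
- by rewrite expr0 scale1r LG.
- by rewrite expr0 scale1r scaleNr linearN /= LG opprB.
rewrite expr1 scaleN1r opprK.
rewrite (weyl_GG (b := ((k + l + e)%:~R - 2 * eps) * b)
  (c := ((k + l + e)%:~R + 2 * eps) / 2)
  TD DT thT etT thD etD thth etet etth).
- by rewrite linearZ /= sv_to_sdU /= scalerN.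
- by rewrite !rmorphD /= eE; ring.
by rewrite !rmorphD /= eE; field.
Qed.

(** Compatibility with the supercommutator: by bilinearity, it is enough to
    check basis elements. *)
Lemma sv_to_sdM i j x y : homog i x -> homog j y ->
  sv_to_sd (lie x y) =
  sv_to_sd x * sv_to_sd y - (-1) ^+ (i && j) *: (sv_to_sd y * sv_to_sd x).
Proof.
move=> hx hy; move: x hx; apply: sv_homog_ind.
- rewrite (linear_fun0 (lie_linearl y)).
  by rewrite !linear0 mul0r mulr0 scaler0 subr0.
- move=> a u v IHu IHv; rewrite lie_linearl !sv_to_sd_linear IHu IHv.
  rewrite mulrDl mulrDr -scalerAl -scalerAr scalerBr scalerDr !scalerA.
  by rewrite [a * _]mulrC opprD addrACA.
move=> x <-; move: y hy; apply: sv_homog_ind.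
- rewrite (linear_fun0 (lie_linearr _)).
  by rewrite !linear0 mul0r mulr0 scaler0 subr0.
- move=> a u v IHu IHv; rewrite lie_linearr !sv_to_sd_linear IHu IHv.
  rewrite mulrDl mulrDr -scalerAl -scalerAr scalerBr scalerDr !scalerA.
  by rewrite [a * _]mulrC opprD addrACA.
by move=> y <-; rewrite !sv_to_sdU -sv_to_sd_basisM -sv_lieU.
Qed.

End SuperVirasoroToSD.

(** * Restriction of scalars *)

Section Pullback.
Variables (K : numFieldType) (L : lieSuperalgType K) (A : superalgType K).
Variable phi : {linear L -> A}.
Hypothesis homog_phi : forall i x, homog i x -> homog i (phi x).
Hypothesis phiM : forall i j x y, homog i x -> homog j y ->
  phi (lie x y) = phi x * phi y - (-1) ^+ (i && j) *: (phi y * phi x).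

(** An A-module as an L-module, through an even homomorphism phi from L to A
    with its supercommutator. *)
Definition pull_action (V : alg_module A) : lie_action L V.
Proof.
exists (fun x => @act K A V (phi x)).
- by move=> v a x y; rewrite linearP act_linearl.
- by move=> x; apply: act_linearr.
- move=> i j x y v hx hy.
  by rewrite (phiM hx hy) addrC -scaleNr act_linearl !actM scaleNr addrC.
by move=> i j x v hx hv; apply: homog_act (homog_phi hx) hv.
Defined.

(** A morphism of A-modules is the same map between the pulled-back modules. *)
Definition pull_hom (V W : alg_module A) (f : alg_hom V W) :
  lie_hom (LieModule (pull_action V)) (LieModule (pull_action W)).
Proof.
exists (f : V -> W).
- exact: alg_hom_linear.
- exact: alg_hom_homog.
by move=> x v; apply: alg_hom_act.
Defined.

Definition pull_functor : functorial (C := ModAlg A) (D := ModLie L)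
  (fun V : ModAlg A => LieModule (pull_action V)).
Proof.
by exists pull_hom => *; apply: lie_hom_ext.
Defined.

End Pullback.

Theorem theorem3p5 (R : realType) (e : bool) (b : R[i]) :
  let eps : R[i] := sv_eps R[i] e in
  let t : int -> SD R[i] := @sd_tpow R[i] in
  let D := sd_D R[i] in
  let th := sd_th R[i] in
  let dth := sd_dth R[i] in
  exists (rho : forall V : ModAlg (SD R[i]), lie_action (svir R[i] e) V)
         (F : functorial (D := ModLie (svir R[i] e))
                (fun V : ModAlg (SD R[i]) => LieModule (rho V))),
    [/\ forall (V : ModAlg (SD R[i])) (m : int) (v : V),
          rho V (sv_L R[i] e m) v =
            - act (t m * (D + ((m%:~R - 2 * eps) * b)%:A
                          + ((m%:~R + 2 * eps) / 2) *: (th * dth))) v,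
        forall (V : ModAlg (SD R[i])) (k : int) (v : V),
          let p : R[i] := k%:~R + eps in
          rho V (sv_G R[i] e k) v =
            act (t k * (th * D + (2 * (p - eps) * b) *: th - t e * dth)) v &
        forall (V W : ModAlg (SD R[i])) (f : mor V W) (v : V),
          (fmap F f : lie_hom _ _) v = (f : alg_hom V W) v].
Proof.
move=> eps t D th dth.
pose phi := @sv_to_sd R[i] e b : {linear svir R[i] e -> SD R[i]}.
pose hphi := @homog_sv_to_sd R[i] e b; pose phiM := @sv_to_sdM R[i] e b.
exists (fun V : ModAlg _ => @pull_action _ _ _ phi hphi phiM V).
exists (@pull_functor _ _ _ phi hphi phiM); split=> //.
- by move=> V m v /=; rewrite sv_to_sdU (linear_funN (act_linearl v)).
by move=> V k p v /=; rewrite sv_to_sdU.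
Qed.
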